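(* Let $n\ge 1$ and $k$ be integers with $1\le k\leq n/2$, and let $V$ be a complex vector subspace of $\Lambda^{k}\mathbb{C}^{n}$ such that $x\wedge y=0$ for all $x,y\in V$. Then $\dim V\leq\binom{n-1}{k-1}$.
   Context: $\Lambda\mathbb{C}^{n}$ denotes the exterior algebra over $\mathbb{C}^{n}$: the $\mathbb{C}$-algebra generated by the standard basis $e_{1},\dots,e_{n}$ of $\mathbb{C}^n$ with product $\wedge$, subject to $x\wedge x=0$ for $x\in\mathbb{C}^{n}$. $\Lambda^{k}\mathbb{C}^{n}$ is its $k$th homogeneous component, spanned by the products $e_{i_1}\wedge\cdots\wedge e_{i_k}$. *)

(* Defs.v *)
From HB Require Import structures.
From mathcomp Require Import all_boot all_order all_algebra all_field.

Set Implicit Arguments.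
Unset Strict Implicit.
Unset Printing Implicit Defensive.

Import GRing.Theory.
Local Open Scope ring_scope.

(* The exterior algebra of F^n on coordinate functions: the value of x at
   S = {i_1 < ... < i_k} is the coefficient in x of e_(i_1) /\ ... /\ e_(i_k).
   The exterior product is the ring product _ * _ of this type, defined by
   ext_mul, and not the pointwise product of functions.  By ext_vec_sq and
   ext_univ this is the F-algebra presented by the generators e_i and the
   relations v * v = 0 for v in F^n. *)
Definition exterior (F : fieldType) (n : nat) : Type :=
  {ffun {set 'I_n} -> F}.

HB.instance Definition _ (F : fieldType) (n : nat) :=
  Vector.copy (exterior F n) {ffun {set 'I_n} -> F^o}.

(* The number of inversions: pairs (i, j) in S x T with j < i. *)
Definition ninv (n : nat) (S T : {set 'I_n}) : nat :=
  \sum_(i in S) #|[set j in T | (j < i)%N]|.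

Section ExteriorRing.
Variables (F : fieldType) (n : nat).
Implicit Types (x y z : exterior F n) (S T U : {set 'I_n}).

Definition ext_one : exterior F n := [ffun S => (S == set0)%:R].

(* For disjoint S and T, e_S /\ e_T = (-1) ^ ninv S T e_(S :|: T). *)
Definition ext_mul x y : exterior F n :=
  [ffun U : {set 'I_n} => \sum_(S : {set 'I_n} | S \subset U)
     (-1) ^+ ninv S (U :\: S) * (x S * y (U :\: S))].

Lemma ninv0s S : ninv set0 S = 0%N.
Proof. by rewrite /ninv big_set0. Qed.

Lemma ninvs0 S : ninv S set0 = 0%N.
Proof.
rewrite /ninv big1 // => i _; apply: eq_card0 => j.
by rewrite !inE.
Qed.

Lemma ninvUl S T U : [disjoint S & T] ->
  ninv (S :|: T) U = (ninv S U + ninv T U)%N.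
Proof. by move=> dST; rewrite /ninv -bigU //; apply: eq_bigl => i; rewrite inE. Qed.

Lemma ninvUr S T U : [disjoint T & U] ->
  ninv S (T :|: U) = (ninv S T + ninv S U)%N.
Proof.
move=> dTU; rewrite /ninv -big_split /=; apply: eq_bigr => i _.
rewrite -cardsUI [X in _ = (_ + X)%N]eq_card0 ?addn0.
  by apply: eq_card => j; rewrite !inE andb_orl.
move=> j; rewrite !inE; apply/negP => /andP[/andP[jT _] /andP[jU _]].
by have := disjointFr dTU jT; rewrite jU.
Qed.

Lemma setUDs S T : S \subset T -> S :|: (T :\: S) = T.
Proof. by move=> /setIidPr sST; rewrite -{1}sST setID. Qed.

Lemma setUKD S T : [disjoint S & T] -> (S :|: T) :\: S = T.
Proof.
by rewrite disjoint_sym => /setDidPl dTS; rewrite setDUl setDv set0U dTS.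
Qed.

Lemma disjointD S T : [disjoint S & T :\: S].
Proof. by rewrite disjoint_sym disjoints_subset setDE subsetIr. Qed.

Lemma ext_mulA : associative ext_mul.
Proof.
move=> x y z; apply/ffunP => U; rewrite !ffunE; apply/esym.
under eq_bigr => W _ do rewrite ffunE mulr_suml mulr_sumr.
rewrite (exchange_big_dep (fun S : {set 'I_n} => S \subset U)) /=; last first.
  by move=> W S WU SW; apply: subset_trans SW WU.
apply: eq_bigr => S SU; rewrite ffunE 2!mulr_sumr.
rewrite (reindex_onto (fun T => S :|: T) (fun W => W :\: S)) /=; last first.
  by move=> W /andP[_ SW]; rewrite setUDs.
apply: eq_big => [T|T].
  rewrite subsetUl andbT subUset SU subsetD /=; congr (_ && _).
  rewrite disjoint_sym; apply/eqP/idP => [<-|/setUKD//]; exact: disjointD.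
case/andP=> /andP[]; rewrite subUset SU /= => TU _ /eqP eT.
have dST : [disjoint S & T] by rewrite -eT disjointD.
rewrite eT -setDDl.
have sTU : T \subset U :\: S by rewrite subsetD TU disjoint_sym.
have -> : ninv S (U :\: S) = (ninv S T + ninv S (U :\: S :\: T))%N.
  by rewrite -ninvUr ?disjointD // setUDs.
rewrite ninvUl // !exprD.
move: (_ ^+ ninv S T) (_ ^+ ninv S _) (_ ^+ ninv T _) => a b c.
rewrite !mulrA -[LHS]mulrA -[RHS]mulrA; congr (_ * _).
by rewrite (mulrC _ a) mulrA mulrAC.
Qed.

Lemma ext_mul1l : left_id ext_one ext_mul.
Proof.
move=> x; apply/ffunP => U; rewrite ffunE (bigD1 set0) ?sub0set //=.
rewrite big1 => [|S /andP[_ /negPf S0]]; last by rewrite ffunE S0 mul0r mulr0.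
by rewrite ninv0s setD0 ffunE eqxx !mul1r addr0.
Qed.

Lemma ext_mul1r : right_id ext_one ext_mul.
Proof.
move=> x; apply/ffunP => U; rewrite ffunE (bigD1 U) //=.
rewrite big1 => [|S /andP[SU nSU]]; last first.
  rewrite ffunE setD_eq0; case: (boolP (U \subset S)) => US; last first.
    by rewrite !mulr0.
  by rewrite eqEsubset SU US in nSU.
by rewrite setDv ninvs0 ffunE eqxx mulr1 mul1r addr0.
Qed.

Lemma ext_mulDl : left_distributive ext_mul +%R.
Proof.
move=> x y z; apply/ffunP => U; rewrite !ffunE -big_split /=.
by apply: eq_bigr => S _; rewrite ffunE mulrDl mulrDr.
Qed.

Lemma ext_mulDr : right_distributive ext_mul +%R.
Proof.
move=> x y z; apply/ffunP => U; rewrite !ffunE -big_split /=.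
by apply: eq_bigr => S _; rewrite ffunE mulrDr mulrDr.
Qed.

Lemma ext_one_neq0 : ext_one != 0.
Proof. by apply/eqP => /ffunP/(_ set0)/eqP; rewrite !ffunE eqxx oner_eq0. Qed.

HB.instance Definition _ := GRing.Zmodule_isNzRing.Build (exterior F n)
  ext_mulA ext_mul1l ext_mul1r ext_mulDl ext_mulDr ext_one_neq0.

Lemma ext_scaleAl (a : F) x y : a *: (x * y) = (a *: x) * y.
Proof.
apply/ffunP => U; rewrite !ffunE [LHS]mulr_sumr; apply: eq_bigr => S _.
by rewrite ffunE -mulrA mulrCA.
Qed.

HB.instance Definition _ :=
  GRing.Lmodule_isLalgebra.Build F (exterior F n) ext_scaleAl.

Lemma ext_scaleAr (a : F) x y : a *: (x * y) = x * (a *: y).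
Proof.
apply/ffunP => U; rewrite !ffunE [LHS]mulr_sumr; apply: eq_bigr => S _.
by rewrite ffunE mulrCA; congr (_ * _); rewrite mulrCA.
Qed.

HB.instance Definition _ :=
  GRing.Lalgebra_isAlgebra.Build F (exterior F n) ext_scaleAr.

HB.instance Definition _ := Algebra_isFalgebra.Build F (exterior F n).

End ExteriorRing.

Definition ext_basis (F : fieldType) (n : nat) (S : {set 'I_n}) :
  exterior F n := [ffun T => (T == S)%:R].

Definition ext_gen (F : fieldType) (n : nat) (i : 'I_n) : exterior F n :=
  ext_basis F [set i].

(* The inclusion of F^n into its exterior algebra. *)
Definition ext_vec (F : fieldType) (n : nat) (v : 'rV[F]_n) : exterior F n :=
  \sum_i v 0 i *: ext_gen F i.

(* The k-th homogeneous component, spanned by the products of k generators. *)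
Definition ext_pow (F : fieldType) (n k : nat) : {vspace exterior F n} :=
  <<[seq \prod_(i <- t) ext_gen F i | t : k.-tuple 'I_n]>>%VS.

Section ExteriorTheory.
Variables (F : fieldType) (n : nat).
Implicit Types (x y z : exterior F n) (S T U : {set 'I_n}).
Local Notation e := (@ext_gen F n).
Local Notation eb := (@ext_basis F n).

Lemma ext_basisM S T :
  eb S * eb T = if [disjoint S & T] then (-1) ^+ ninv S T *: eb (S :|: T) else 0.
Proof.
apply/ffunP => U; rewrite [LHS]ffunE.
transitivity ((S \subset U)%:R * ((-1) ^+ ninv S (U :\: S) *
               (U :\: S == T)%:R) : F).
  case: (boolP (S \subset U)) => [SU|SU].
    rewrite (bigD1 S) //= big1 => [|W /andP[_ /negPf WS]]; last first.
      by rewrite ffunE WS mul0r mulr0.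
    by rewrite !ffunE eqxx !mul1r addr0.
  rewrite big1 ?mul0r // => W WU; rewrite ffunE.
  by case: eqP => [WS|_]; [rewrite -WS WU in SU | rewrite mul0r mulr0].
case: (boolP [disjoint S & T]) => dST; rewrite !ffunE; last first.
  case: eqP => [TU|_]; last by rewrite !mulr0.
  by rewrite -TU disjointD in dST.
case: (U =P S :|: T) => [->|nU].
  by rewrite setUKD // subsetUl eqxx mul1r mulr1 [RHS]mulr1.
rewrite [RHS]mulr0; case: (boolP (S \subset U)) => SU; last by rewrite mul0r.
by case: eqP => [TU|_]; [case: nU; rewrite -TU setUDs | rewrite !mulr0].
Qed.

Lemma ext_expand_basis x : x = \sum_S x S *: eb S.
Proof.
apply/ffunP => U; rewrite sum_ffunE (bigD1 U) //= big1 => [|S /negPf SU].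
  by rewrite !ffunE eqxx addr0 [RHS]mulr1.
by rewrite !ffunE eq_sym SU [LHS]mulr0.
Qed.

Lemma ninv11 (i j : 'I_n) : ninv [set i] [set j] = (j < i)%N.
Proof.
rewrite /ninv big_set1; case: (boolP (j < i)%N) => ji.
  apply: (@eq_card1 _ j) => l; rewrite !inE.
  by case: eqP => // ->.
apply: eq_card0 => l; rewrite !inE; case: eqP => // -> /=.
by rewrite (negPf ji).
Qed.

Lemma ext_gen_sq i : e i * e i = 0.
Proof.
by rewrite ext_basisM -setI_eq0 setIid; case: eqP => // /setP/(_ i);
   rewrite !inE eqxx.
Qed.

Lemma ext_gen_anti i j : e i * e j = - (e j * e i).
Proof.
case: (eqVneq i j) => [->|ij]; first by rewrite ext_gen_sq oppr0.
rewrite !ext_basisM !disjoints1 !inE ij eq_sym ij /= !ninv11 setUC -scaleNr.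
by congr (_ *: _); case: (ltngtP i j) ij => [||/val_inj->]; rewrite ?eqxx ?opprK.
Qed.

Lemma ext_vec_sq (v : 'rV[F]_n) : ext_vec v * ext_vec v = 0.
Proof.
rewrite /ext_vec mulr_suml.
under eq_bigr => i _ do rewrite mulr_sumr.
pose G i j := (v 0 i *: e i) * (v 0 j *: e j).
have GN i j : G i j = - G j i.
  by rewrite /G -!scalerAl -!scalerAr ext_gen_anti !scalerN !scalerA mulrC.
transitivity (\sum_(i < n) (\sum_(j < n | (i < j)%N) G i j +
                      \sum_(j < n | (j < i)%N) G i j)).
  apply: eq_bigr => i _; rewrite (bigID (fun j : 'I_n => (i < j)%N)) /=.
  congr (_ + _); rewrite (bigD1 i) ?ltnn //= -scalerAl -scalerAr ext_gen_sq.
  rewrite !scaler0 add0r; apply: eq_bigl => j.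
  by rewrite -leqNgt ltn_neqAle andbC.
rewrite big_split /= [X in _ + X](exchange_big_dep predT) //= -big_split /=.
by apply: big1 => i _; rewrite -big_split /= big1 // => j _; rewrite GN subrr || rewrite (GN j i) subrr.
Qed.

Let lto : rel 'I_n := relpre (@nat_of_ord n) ltn.

Let lto_tr : transitive lto.
Proof. by move=> ? ? ?; apply: ltn_trans. Qed.

Let lto_index_enum : sorted lto (index_enum 'I_n).
Proof.
by rewrite [index_enum _]unlock -enumT -sorted_map val_enum_ord iota_ltn_sorted.
Qed.

Lemma ext_basisE S : eb S = \prod_(i in S) e i.
Proof.
have H (l : seq 'I_n) : sorted lto l -> \prod_(i <- l) e i = eb [set:: l].
  elim: l => [_|a l IH].
    by rewrite big_nil set_nil; apply/ffunP => T; rewrite !ffunE.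
  rewrite /= (path_sortedE lto_tr) => /andP[/allP al sl].
  rewrite big_cons IH // ext_basisM set_cons disjoints1 inE.
  rewrite ifT; last by apply/negP => /al; rewrite /lto /= ltnn.
  rewrite /ninv big_set1 eq_card0 ?scale1r // => j.
  rewrite !inE; apply/negP => /andP[/al aj ja].
  by have := ltn_trans aj ja; rewrite ltnn.
rewrite -big_filter H; last exact: sorted_filter.
by congr eb; apply/setP => i; rewrite inE mem_filter mem_index_enum andbT.
Qed.

Lemma ext_expand x : x = \sum_S x S *: \prod_(i in S) e i.
Proof.
by rewrite {1}(ext_expand_basis x); under eq_bigr do rewrite ext_basisE.
Qed.

Section Universal.
Variables (A : algType F) (f : {linear 'rV[F]_n -> A}).
Hypothesis f_sq : forall v, f v * f v = 0.

Let g (i : 'I_n) : A := f (delta_mx 0 i).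

Let g_anti i j : g i * g j = - (g j * g i).
Proof.
apply/eqP; rewrite -addr_eq0; apply/eqP.
have := f_sq (delta_mx 0 i + delta_mx 0 j).
by rewrite linearD mulrDl !mulrDr !f_sq addr0 add0r.
Qed.

Let lift (x : exterior F n) : A := \sum_S x S *: \prod_(i in S) g i.

Let g_prod i T (l : seq 'I_n) : sorted lto l -> i \in l -> i \notin T ->
  g i * \prod_(j <- l | j \in T) g j =
  (-1) ^+ count (fun j : 'I_n => (j \in T) && (j < i)%N) l
    *: \prod_(j <- l | j \in i |: T) g j.
Proof.
move=> + + iT; elim: l => // a l IH.
rewrite /= (path_sortedE lto_tr) => /andP[/allP al sl].
rewrite !big_cons in_cons !inE; case: (eqVneq i a) => [ia _|ia /= il].
  subst a; rewrite (negPf iT) (_ : count _ _ = 0%N) ?scale1r; last first.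
    apply/eqP; rewrite -leqn0 leqNgt -has_count; apply/hasPn => j /al ij.
    by rewrite negb_and -leqNgt (ltnW ij) orbT.
  congr (_ * _); rewrite big_seq_cond [RHS]big_seq_cond.
  apply: eq_bigl => j; rewrite !inE; case: (eqVneq j i) => [->|//].
  by rewrite (negPf iT) andbF; apply/esym/negP => /andP[/al]; rewrite /lto /= ltnn.
have {}IH := IH sl il.
have ai : (a < i)%N by apply: al.
rewrite ai andbT; case: (boolP (a \in T)) => aT /=.
  by rewrite mulrA g_anti mulNr -mulrA IH exprS mulN1r scaleNr scalerAr.
by rewrite IH add0n.
Qed.

Let lift_linear : linear lift.
Proof.
move=> a x y; rewrite /lift scaler_sumr -big_split; apply: eq_bigr => S _.
by rewrite !ffunE scalerDl scalerA.
Qed.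

HB.instance Definition _ :=
  GRing.isLinear.Build F (exterior F n) A _ lift lift_linear.

Let lift_basis S : lift (eb S) = \prod_(i in S) g i.
Proof.
rewrite /lift (bigD1 S) //= [X in _ + X]big1 => [|T /negPf TS].
  by rewrite ffunE eqxx scale1r addr0.
by rewrite ffunE TS scale0r.
Qed.

Let g_prod1 i T : i \notin T -> g i * \prod_(j in T) g j =
  (-1) ^+ ninv [set i] T *: \prod_(j in i |: T) g j.
Proof.
move=> iT; rewrite g_prod ?mem_index_enum // /ninv big_set1 -sum1_card -sum1_count.
by congr ((-1) ^+ _ *: _); apply: eq_bigl => j; rewrite inE.
Qed.

Let lift_genM i y : lift (e i * y) = g i * lift y.
Proof.
rewrite [y]ext_expand_basis mulr_sumr !linear_sum mulr_sumr; apply: eq_bigr => T _.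
rewrite -scalerAr !linearZ_LR -scalerAr; congr (_ *: _).
rewrite /= lift_basis ext_basisM disjoints1.
case: (boolP (i \in T)) => iT; rewrite ?linear0 ?linearZ_LR /=; last first.
  by rewrite lift_basis g_prod1.
have := @g_prod1 i (T :\ i); rewrite !inE eqxx setD1K // => /(_ isT) eT.
have -> : \prod_(j in T) g j =
    (-1) ^+ ninv [set i] (T :\ i) *: (g i * \prod_(j in T :\ i) g j).
  by rewrite eT scalerA -expr2 sqrr_sign scale1r.
by rewrite -scalerAr mulrA f_sq mul0r scaler0.
Qed.

Let lift_mul x y : lift (x * y) = lift x * lift y.
Proof.
rewrite [x]ext_expand_basis mulr_suml !linear_sum mulr_suml.
apply: eq_bigr => S _; rewrite -scalerAl !linearZ_LR -scalerAl; congr (_ *: _).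
rewrite /= lift_basis ext_basisE; elim: (index_enum _) => [|i l IH].
  by rewrite !big_nil !mul1r.
by rewrite !big_cons; case: ifP => // _; rewrite -!mulrA lift_genM IH.
Qed.

Let lift_one : lift 1 = 1.
Proof.
have -> : 1 = eb set0 by apply/ffunP => T; rewrite !ffunE.
by rewrite lift_basis big_set0.
Qed.

HB.instance Definition _ :=
  GRing.isMonoidMorphism.Build (exterior F n) A lift (lift_one, lift_mul).

Lemma ext_univ : exists h : {lrmorphism exterior F n -> A},
  (forall v, h (ext_vec v) = f v) /\
  forall h' : {lrmorphism exterior F n -> A},
    (forall v, h' (ext_vec v) = f v) -> h' =1 h.
Proof.
exists lift; split=> [v|h' h'f x].
  rewrite linear_sum [v in RHS]row_sum_delta linear_sum; apply: eq_bigr => i _.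
  by rewrite !linearZ_LR /= lift_basis big_set1.
rewrite (ext_expand x) !linear_sum; apply: eq_bigr => S _.
rewrite !linearZ_LR !rmorph_prod; congr (_ *: _); apply: eq_bigr => i _.
rewrite /= lift_basis big_set1 /g -h'f; congr (h' _).
rewrite /ext_vec (bigD1 i) //= big1 ?mxE ?eqxx ?scale1r ?addr0 //.
by move=> j /negPf ji; rewrite mxE ji andbF scale0r.
Qed.

End Universal.

End ExteriorTheory.

(* Main.v *)
From HB Require Import structures.
Require Import Defs.
From mathcomp Require Import all_boot all_order all_algebra all_field.
From mathcomp Require Import fingroup perm boolp reals.
From mathcomp Require Import complex.
From mathcomp Require Import zify.

(** Order the subsets of [{0, .., n-1}] by the integer they encode in binary.
  This order is additive on disjoint unions, so the leading monomial of a
  product [x * y] is the product of the leading monomials of [x] and [y]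
  whenever these are disjoint.  Hence, if the products of elements of [V]
  vanish, the leading sets of the nonzero elements of [V] form an intersecting
  family of [k]-sets.  There are at least [\dim V] of them, and the
  Erdos-Ko-Rado theorem, proved by Katona's cycle method, bounds their number
  by [C(n-1, k-1)]. *)

Set Implicit Arguments.
Unset Strict Implicit.
Unset Printing Implicit Defensive.

Import GRing.Theory.
Local Open Scope ring_scope.
Local Open Scope complex_scope.

(** * The Erdos-Ko-Rado theorem *)

Section ErdosKoRado.
Local Open Scope nat_scope.
Variable n : nat.
Implicit Types (i j x : 'I_n) (A B S : {set 'I_n}).

(* The residue of [x - i] modulo [n], for [i, x < n]. *)
Definition cyc_dist (i x : nat) : nat := if i <= x then x - i else x + n - i.

Definition arc (k : nat) i : {set 'I_n} := [set x : 'I_n | cyc_dist i x < k].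

Lemma cyc_dist_lt i x : cyc_dist i x < n.
Proof. by have := ltn_ord x; rewrite /cyc_dist; case: (leqP i x); lia. Qed.

(** The map [cyc_dist i] permutes the residues [0, ..., n - 1], and the arc is the preimage of the
    first [k] of them. *)
Lemma card_arc k i : k <= n -> #|arc k i| = k.
Proof.
move=> kn; pose f x := Ordinal (cyc_dist_lt i x).
have f_inj : injective f.
  move=> x y /(congr1 val); rewrite /= /cyc_dist => fxy; apply: val_inj => /=.
  move: fxy (ltn_ord x) (ltn_ord y) (ltn_ord i).
  by case: (leqP i x) => ?; case: (leqP i y) => ?; lia.
have -> : arc k i = f @^-1: [set j : 'I_n | j < k].
  by apply/setP => x; rewrite !inE.
rewrite on_card_preimset; last exact/onW_bij/injF_bij.
have widen_inj : injective (widen_ord kn).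
  by move=> x y /(congr1 val)/= xy; apply: val_inj.
rewrite -[RHS]card_ord -(card_imset _ widen_inj).
apply: eq_card => x; rewrite !inE; apply/idP/imsetP => [xk|[y _ ->]].
  by exists (Ordinal xk) => //; apply: val_inj.
exact: (ltn_ord y).
Qed.

(* Seen from a fixed start in [I], the other starts fall into the [k - 1] pairs
   {d, d + n - k}, each pair giving two disjoint arcs. *)
Lemma card_intersecting_arcs k (I : {set 'I_n}) : 2 * k <= n ->
  {in I &, forall i j, ~~ [disjoint arc k i & arc k j]} -> #|I| <= k.
Proof.
move=> kn intI; case: (set_0Vmem I) => [->|[o oI]]; first by rewrite cards0.
have near i j : i \in I -> j \in I ->
    (cyc_dist i j < k) || (n - k < cyc_dist i j).
  move=> iI jI; have /pred0Pn[x] := intI _ _ iI jI; rewrite /= !inE.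
  move: (ltn_ord x) (ltn_ord j) (ltn_ord i); rewrite /cyc_dist.
  by case: (leqP i x) => ?; case: (leqP j x) => ?; case: (leqP i j) => ?; lia.
pose g i := if cyc_dist o i < k then cyc_dist o i else cyc_dist o i + k - n.
have g_lt i : i \in I -> g i < k.
  move=> iI; rewrite /g; case: (ltnP (cyc_dist o i) k) => //.
  by have := near o i oI iI; have := cyc_dist_lt o i; lia.
(* Distinct starts with equal values would lie at cyclic distances [k] and [n - k] from each other,
   which [near] excludes since [2 * k <= n]. *)
have g_inj : {in I &, injective g}.
  move=> i j iI jI gij; apply: val_inj => /=.
  move: gij (near _ _ oI iI) (near _ _ oI jI) (near _ _ iI jI).
  move: (ltn_ord o) (ltn_ord j) (ltn_ord i); rewrite /g.
  case: (ltnP (cyc_dist o i) k); case: (ltnP (cyc_dist o j) k);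
    rewrite /cyc_dist; case: (leqP o i) => ?; case: (leqP o j) => ?;
    case: (leqP i j) => ?; lia.
have -> : #|I| = size (map g (enum I)) by rewrite size_map -cardE.
rewrite -[leqRHS](size_iota 0); apply: uniq_leq_size.
  rewrite map_inj_in_uniq ?enum_uniq // => x y.
  by rewrite !mem_enum; apply: g_inj.
  by move=> d /mapP[i iI ->]; rewrite mem_iota g_lt // -mem_enum.
Qed.

End ErdosKoRado.

(** * Counting permutations by the image of a set *)

(** List [A] before its complement, list [B] before its own, and match the two lists position by
    position. *)
Lemma perm_set_transitive (T : finType) (A B : {set T}) : #|A| = #|B| ->
  exists s : {perm T}, s @: A = B.
Proof.
move=> AB; pose e (S : {set T}) := enum S ++ enum (~: S).
have mem_e (S : {set T}) x : x \in e S.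
  by rewrite mem_cat !mem_enum inE orbN.
have uniq_e (S : {set T}) : uniq (e S).
  rewrite cat_uniq !enum_uniq andbT /=; apply/hasPn => x.
  by rewrite !mem_enum inE.
have size_e (S : {set T}) : size (e S) = #|T|.
  by rewrite size_cat -!cardE cardsC.
have ltxe x : (index x (e A) < size (e B))%N.
  by rewrite size_e -(size_e A) index_mem.
(* The default [x] is never reached, as both lists have length [#|T|]. *)
pose f x := nth x (e B) (index x (e A)).
have f_inj : injective f.
  move=> x y; rewrite /f (set_nth_default y) ?ltxe // => /eqP.
  rewrite nth_uniq ?ltxe // => /eqP xy.
  by rewrite -(nth_index x (mem_e A x)) xy nth_index.
exists (perm f_inj); apply/eqP; rewrite eqEcard card_imset ?AB ?leqnn ?andbT;
  last exact: perm_inj.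
apply/subsetP => _ /imsetP[x xA ->]; rewrite permE /f /e index_cat mem_enum xA.
rewrite nth_cat -cardE -AB [X in (_ < X)%N]cardE index_mem mem_enum xA.
by rewrite -mem_enum mem_nth // -cardE -AB cardE index_mem mem_enum.
Qed.

(** Composing with a permutation that carries [B'] to [B] shows that all targets of size [#|A|] are
    hit equally often; there are ['C(#|T|, #|A|)] of them. *)
Lemma card_perm_imset_eq (T : finType) (A B : {set T}) : #|A| = #|B| ->
  (#|[set s : {perm T} | s @: A == B]| * 'C(#|T|, #|A|) = #|{perm T}|)%N.
Proof.
move=> AB; pose N B' := #|[set s : {perm T} | s @: A == B']|.
have NE (B' : {set T}) : #|B'| = #|A| -> N B' = N B.
  move=> B'A; have [t tB] := perm_set_transitive (etrans B'A AB).
  rewrite /N -(card_imset _ (@mulIg _ t)); apply: eq_card => s.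
  rewrite inE; apply/imsetP/eqP => [[r]|sB].
    rewrite inE => /eqP rA ->; rewrite -tB -rA -imset_comp.
    by apply: eq_imset => x; rewrite permM.
  exists (s * t^-1)%g; last by rewrite mulgKV.
  rewrite inE; apply/eqP; apply: (imset_inj (@perm_inj _ t)).
  rewrite tB -sB -imset_comp; apply: eq_imset => x.
  by rewrite /= -permM mulgKV.
rewrite -card_draws -/(N B) mulnC -sum_nat_const -[RHS]sum1_card.
rewrite (partition_big (fun s : {perm T} => s @: A)
  (mem [set S : {set T} | #|S| == #|A|])) /=; last first.
  by move=> s _; rewrite inE card_imset //; apply: perm_inj.
apply: eq_bigr => S; rewrite inE => /eqP /NE <-; rewrite /N -sum1_card.
by apply: eq_bigl => s; rewrite inE.
Qed.

Theorem erdos_ko_rado (n k : nat) (E : {set {set 'I_n}}) :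
  (0 < k)%N -> (2 * k <= n)%N -> {in E, forall S : {set 'I_n}, #|S| = k} ->
  {in E &, forall S T : {set 'I_n}, ~~ [disjoint S & T]} ->
  (#|E| <= 'C(n.-1, k.-1))%N.
Proof.
move=> k0 kn kE intE.
have [->|[B BE]] := set_0Vmem E; first by rewrite cards0.
have le_kn : (k <= n)%N by lia.
have n0 : (0 < n)%N by lia.
(* The division is exact, as [NC] confirms. *)
pose N := (#|{perm 'I_n}| %/ 'C(n, k))%N.
have NE S i : S \in E -> #|[set s : {perm 'I_n} | s @: arc k i == S]| = N.
  move=> SE; rewrite /N -(@card_perm_imset_eq _ (arc k i) S) ?card_arc ?kE //.
  by rewrite card_ord mulnK // bin_gt0.
have NC : (N * 'C(n, k) = #|{perm 'I_n}|)%N.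
  rewrite -(NE B (Ordinal n0)) //.
  by rewrite -(@card_perm_imset_eq _ (arc k (Ordinal n0)) B) ?card_ord ?card_arc ?kE.
have N0 : (0 < N)%N.
  have : (0 < #|{perm 'I_n}|)%N by apply/card_gt0P; exists 1%g.
  by rewrite -NC muln_gt0 => /andP[].
(* Counts the triples (s, i, S) such that the permutation [s] maps the arc
   starting at [i] onto [S]. *)
have count : (#|E| * n * N <= #|{perm 'I_n}| * k)%N.
  rewrite -[leqRHS]sum_nat_const.
  apply: (@leq_trans (\sum_(s : {perm 'I_n}) \sum_(i < n) (s @: arc k i \in E))%N);
    last first.
    (* A fixed [s] preserves disjointness, so the arcs that it sends into [E] meet pairwise and
       there are at most [k] of them. *)
    apply: leq_sum => s _; rewrite -big_mkcond /= sum1dep_card.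
    apply: (card_intersecting_arcs kn) => i j; rewrite !inE => iE jE.
    apply: contra (intE _ _ iE jE).
    by rewrite -!setI_eq0 -imsetI ?imset_eq0 // => x y _ _; apply: perm_inj.
  rewrite exchange_big /= -mulnA mulnCA -[X in (X * _ <= _)%N]card_ord.
  rewrite -sum_nat_const.
  apply: leq_sum => i _; rewrite -sum_nat_const.
  rewrite (eq_bigr (fun s : {perm 'I_n} => (\sum_(S in E) (s @: arc k i == S))%N));
    last first.
    move=> s _; case: (boolP (_ \in E)) => sE.
      rewrite (bigD1 _ sE) /= eqxx big1 // => S /andP[_].
      by rewrite eq_sym => /negPf ->.
    rewrite big1 // => S SE; case: eqP => // eS.
    by rewrite eS SE in sE.
  rewrite exchange_big /=; apply: leq_sum => S SE.
  by rewrite -(NE S i SE) -big_mkcond sum1dep_card.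
(* Cancelling [N] leaves [#|E| * n <= 'C(n, k) * k], and the right side equals
   [n * 'C(n.-1, k.-1)]. *)
move: count; rewrite -NC -!mulnA [(n * N)%N]mulnC mulnCA leq_pmul2l //.
case: k k0 {kn kE le_kn N NE NC N0} => // k _.
case: n n0 E {intE B BE} => // n _ E; rewrite [X in (_ <= X)%N]mulnC -mul_bin_diag.
by rewrite mulnC leq_pmul2l.
Qed.

(** * Leading monomials *)

Section LeadingSet.
Variables (F : fieldType) (n : nat).
Implicit Types (x y : exterior F n) (S T U : {set 'I_n}).

Definition binary_code S : nat := \sum_(i in S) 2 ^ i.

(** Binary expansions are unique: parity determines the lowest digit, and induction the others. *)
Lemma binary_code_inj : injective binary_code.
Proof.
have digits m (f g : nat -> bool) :
    (\sum_(i < m) f i * 2 ^ i = \sum_(i < m) g i * 2 ^ i)%N ->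
    forall i, (i < m)%N -> f i = g i.
  elim: m f g => // m IH f g.
  have tail (h : nat -> bool) : (\sum_(i < m.+1) h i * 2 ^ i =
      h 0 + 2 * \sum_(i < m) h i.+1 * 2 ^ i)%N.
    rewrite big_ord_recl muln1 big_distrr; congr addn.
    by apply: eq_bigr => i _; rewrite /= expnS mulnCA.
  rewrite !tail => fg [_|i].
    by move: fg; case: (f 0%N); case: (g 0%N); lia.
  rewrite ltnS; apply: (IH (fun i => f i.+1) (fun i => g i.+1)).
  by move: fg; case: (f 0%N); case: (g 0%N); lia.
(* Membership is extended to all of [nat] because the induction in [digits] shifts indices. *)
move=> S T; pose d S (i : nat) := [exists j in S, val j == i].
have dE S' (i : 'I_n) : d S' i = (i \in S').
  apply/existsP/idP => [[j /andP[jS /eqP/val_inj <-]]//|iS].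
  by exists i; rewrite iS eqxx.
have code S' : binary_code S' = (\sum_(i < n) d S' i * 2 ^ i)%N.
  rewrite /binary_code big_mkcond; apply: eq_bigr => i _; rewrite dE.
  by case: ifP; rewrite ?mul1n ?mul0n.
rewrite !code => /digits ST; apply/setP => i; rewrite -!dE.
exact/ST/ltn_ord.
Qed.

Lemma binary_codeU S T : [disjoint S & T] ->
  binary_code (S :|: T) = (binary_code S + binary_code T)%N.
Proof.
by move=> dST; rewrite /binary_code -bigU //; apply: eq_bigl => i; rewrite inE.
Qed.

Definition lead_set x S : Prop :=
  x S != 0 /\ forall T, x T != 0 -> (binary_code T <= binary_code S)%N.

Lemma lead_set_exists x : x != 0 -> exists S, lead_set x S.
Proof.
move=> x0; have [S0 S0P] : exists S, x S != 0.
  apply/existsP; apply: contra_neqT x0; rewrite negb_exists => /forallP xS.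
  by apply/ffunP => S; rewrite ffunE; apply/eqP/negPn.
case: (@arg_maxnP _ S0 (fun S => x S != 0) binary_code S0P) => S xS maxS.
by exists S.
Qed.

(** If [S] and [T] were disjoint, the coefficient of [x * y] at their union would be, up to sign,
    [x S * y T]. Any other contributing splitting has codes bounded by those of [S] and [T] with the
    same sum, hence equal to them. *)
Lemma lead_setM x y S T : lead_set x S -> lead_set y T -> x * y = 0 ->
  ~~ [disjoint S & T].
Proof.
move=> [xS maxS] [yT maxT] xy0; apply/negP => dST.
have /eqP := congr1 (fun z : exterior F n => z (S :|: T)) xy0.
rewrite /= [X in X == _]ffunE [X in _ == X]ffunE.
rewrite (bigD1 S) ?subsetUl //= big1 ?addr0 => [|S' /andP[S'U nS']].
  by rewrite setUKD // !mulf_eq0 signr_eq0 (negPf xS) (negPf yT).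
have [->|xS'] := eqVneq (x S') 0; first by rewrite mul0r mulr0.
have [->|yT'] := eqVneq (y ((S :|: T) :\: S')) 0; first by rewrite !mulr0.
case/eqP: nS'; apply: binary_code_inj.
have := binary_codeU dST; rewrite -{1}(setUDs S'U) binary_codeU ?disjointD //.
by have := maxS _ xS'; have := maxT _ yT'; lia.
Qed.

(** Restricting coefficients to [L] is a linear map that is injective on [V]. This replaces the
    choice of a basis with distinct leading sets. *)
Lemma dim_le_support (V : {vspace exterior F n}) (L : {set {set 'I_n}}) :
  (forall x, x \in V -> x != 0 -> exists2 S, S \in L & x S != 0) ->
  (\dim V <= #|L|)%N.
Proof.
move=> VL; pose f x : 'rV[F]_#|L| := \row_i x (enum_val i).
have f_lin : linear f.
  by move=> a x y; apply/rowP => i; rewrite !mxE !ffunE.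
pose fL := GRing.isLinear.Build _ _ _ _ f f_lin.
pose g : {linear exterior F n -> 'rV[F]_#|L|} := HB.pack f fL.
rewrite -(@limg_dim_eq _ _ _ (linfun g) V); last first.
  apply/eqP; rewrite -subv0; apply/subvP => x; rewrite memv_cap memv_ker memv0.
  rewrite lfunE /= => /andP[xV /eqP fx]; apply: contraT => x0.
  have [S SL] := VL x xV x0.
  have := congr1 (fun v : 'rV_ _ => v 0 (enum_rank_in SL S)) fx.
  by rewrite !mxE enum_rankK_in // => ->; rewrite eqxx.
by apply: leq_trans (dimvS (subvf _)) _; rewrite dimvf /dim /= mul1n.
Qed.

(** Each spanning product is supported on sets of size [k], by induction on its factors, and
    supports can only shrink under linear combinations to subsets of their union. *)
Lemma card_ext_pow k x S : x \in ext_pow F n k -> x S != 0 -> #|S| = k.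
Proof.
have prodP (t : seq 'I_n) U :
    (\prod_(i <- t) ext_gen F i : exterior F n) U != 0 -> #|U| = size t.
  elim: t U => [|a t IH] U.
    rewrite big_nil ffunE; case: (U =P set0) => [-> _|_]; first exact: cards0.
    by rewrite eqxx.
  rewrite big_cons ffunE => nz.
  have [A AU] : exists2 A : {set 'I_n}, A \subset U &
      ext_gen F a A * (\prod_(i <- t) ext_gen F i : exterior F n) (U :\: A) != 0.
    apply/exists_inP; apply: contra_neqT nz; rewrite negb_exists => /forallP H.
    apply: big1 => A AU; have := H A; rewrite AU /= negbK => /eqP ->.
    by rewrite mulr0.
  rewrite mulf_eq0 negb_or => /andP[]; rewrite ffunE.
  case: (A =P [set a]) => [Aa _ /IH /= <-|_]; last by rewrite eqxx.
  by rewrite -[LHS](cardsID A) (setIidPr AU) Aa cards1.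
move=> xV; rewrite (coord_span xV) sum_ffunE => nz.
set s := image_tuple _ _ in nz.
have [j] : exists j, (coord s j x *: s`_j) S != 0.
  apply/existsP; apply: contra_neqT nz; rewrite negb_exists => /forallP H.
  by apply: big1 => i _; apply/eqP/negPn/H.
rewrite ffunE mulf_eq0 negb_or => /andP[_].
have /mapP[t _ ->] : s`_j \in s by rewrite mem_nth // size_tuple.
by move=> /prodP ->; rewrite size_tuple.
Qed.

End LeadingSet.

Theorem theorem1p4 (R : realType) (n k : nat)
    (hn : (1 <= n)%N) (hk1 : (1 <= k)%N) (hk : (2 * k <= n)%N)
    (V : {vspace exterior R[i] n})
    (hV : (V <= ext_pow R[i] n k)%VS)
    (hV0 : forall x y : exterior R[i] n, x \in V -> y \in V -> x * y = 0) :
  (\dim V <= 'C(n - 1, k - 1))%N.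
Proof.
(* Having a leading element in [V] is a mere proposition, turned into a boolean classically. *)
pose L := [set S | `[< exists2 x : exterior R[i] n, x \in V & lead_set x S >]].
have LP S : S \in L -> exists2 x : exterior R[i] n, x \in V & lead_set x S.
  by rewrite inE => /asboolP.
apply: (@leq_trans #|L|).
  apply: dim_le_support => x xV /lead_set_exists[S xS].
  by exists S; [rewrite inE; apply/asboolP; exists x | case: xS].
rewrite !subn1; apply: erdos_ko_rado => // [S /LP[x xV [xS _]]|S T].
  exact: card_ext_pow (subvP hV x xV) xS.
by move=> /LP[x xV xS] /LP[y yV yT]; apply: lead_setM xS yT (hV0 x y xV yV).
Qed.
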